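(* Let $\mathrm{Subdiv}$ be the set of strong formal subdivisions $\sigma: X\to Y$ between lower Eulerian posets $X$ and $Y$ with rank functions $\rho_X$ and $\rho_Y$. Let $\mathrm{JoinAdm}^\circ$ be the set of triples $(\Gamma,\rho_\Gamma,q)$ where $\Gamma$ is a lower Eulerian poset with rank function $\rho_\Gamma$ and $q\neq \hat 0_\Gamma$ is a join-admissible element of $\Gamma$. Define $$\mathrm{CYL}:\mathrm{Subdiv}\to \mathrm{JoinAdm}^\circ,\qquad \mathrm{CYL}(\sigma:X\to Y)=(\operatorname{Cyl}(\sigma),\rho_{\operatorname{Cyl}(\sigma)},\hat 0_Y),$$ where $\operatorname{Cyl}(\sigma)$ is the non-Hausdorff mapping cylinder of $\sigma$ and $\rho_{\operatorname{Cyl}(\sigma)}(z)=\rho_X(z)$ if $z\in X$, $\rho_{\operatorname{Cyl}(\sigma)}(z)=\rho_Y(z)+1$ if $z\in Y$. Define $$\mathrm{MAP}:\mathrm{JoinAdm}^\circ\to\mathrm{Subdiv},\qquad \mathrm{MAP}(\Gamma,\rho_\Gamma,q):\Gamma\smallsetminus\Gamma_{\ge q}\to\Gamma_{\ge q},\quad x\mapsto x\vee q,$$ where $\Gamma\smallsetminus \Gamma_{\ge q}$ is equipped with the restriction of $\rho_\Gamma$ and $\Gamma_{\ge q}$ is equipped with the restriction of $\rho_\Gamma$ shifted by $-1$ (i.e. $y\mapsto \rho_\Gamma(y)-1$). Then $\mathrm{CYL}$ and $\mathrm{MAP}$ are well-defined, and they are mutually inverse bijections.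
   Context: All posets are finite. In a poset $B$, $z'$ covers $z$ if $z<z'$ and no element lies strictly between them. A rank function for a nonempty poset $B$ is a function $\rho_B:B\to\mathbb{Z}$ with $\rho_B(z')=\rho_B(z)+1$ whenever $z'$ covers $z$; $B$ is ranked if one exists. A ranked poset $B$ is locally Eulerian if $\sum_{z\le z''\le z'}(-1)^{\rho_B(z'')}=0$ for all $z<z'$ in $B$ (independent of the choice of $\rho_B$). It is lower Eulerian if in addition it has a unique minimal element, denoted $\hat 0_B$. Let $X,Y$ be lower Eulerian posets with rank functions $\rho_X,\rho_Y$. A function $\sigma:X\to Y$ is order-preserving if $x\le x'$ implies $\sigma(x)\le\sigma(x')$; rank-increasing if $\rho_X(x)\le\rho_Y(\sigma(x))$ for all $x\in X$. An order-preserving, rank-increasing $\sigma$ is strongly surjective if it is surjective and for all $x\in X$, $y\in Y$ with $\sigma(x)\le y$ there is $x'\in X$ with $x\le x'$, $\rho_X(x')=\rho_Y(y)$ and $\sigma(x')=y$. A strong formal subdivision is an order-preserving, rank-increasing, strongly surjective $\sigma:X\to Y$ such that for all $x\in X$, $y\in Y$ with $\sigma(x)\le y$, $$\sum_{x\le x'\in X,\ \sigma(x')=y}(-1)^{\rho_Y(y)-\rho_X(x')}=1.$$ The rank functions are part of the data. For $z\in B$, $B_{\ge z}=\{z'\in B: z\le z'\}$. The join $z\vee z'$ is the unique minimal element of $B_{\ge z}\cap B_{\ge z'}$, when this set is nonempty and has a unique minimal element (then we say the join exists). An element $q\in B$ is join-admissible if $z\vee q$ exists for all $z\in B$. For an order-preserving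 $\sigma:X\to Y$, the non-Hausdorff mapping cylinder $\operatorname{Cyl}(\sigma)$ is the poset on the disjoint union of $X$ and $Y$ with $z\le z'$ iff (1) $z,z'\in X$ and $z\le z'$ in $X$, or (2) $z,z'\in Y$ and $z\le z'$ in $Y$, or (3) $z\in X$, $z'\in Y$ and $\sigma(z)\le z'$ in $Y$. The sets $X$ and $Y$ are identified with their images in this disjoint union (isomorphic posets are identified in the obvious canonical way). *)

(* Defs.v *)
From HB Require Import structures.
From mathcomp Require Import all_boot all_order all_algebra.

Set Implicit Arguments.
Unset Strict Implicit.
Unset Printing Implicit Defensive.

Import Order.TTheory GRing.Theory Num.Theory.

Local Open Scope order_scope.

Section Posets.
Context {d : Order.disp_t} {B : finPOrderType d}.
Implicit Types (z : B) (A : {set B}) (rho : B -> int).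

Definition covers z' z : Prop := z < z' /\ forall t : B, ~ (z < t < z').

Definition rank_function rho : Prop :=
  (0 < #|B|)%N /\ forall z z', covers z' z -> rho z' = (rho z + 1)%R.

(* The exponent is an integer, possibly negative; -1 is a unit of int. *)
Definition locally_eulerian rho : Prop :=
  rank_function rho /\
  forall z z', z < z' -> (\sum_(t : B | (z <= t <= z')%O) (-1 : int) ^ rho t = 0)%R.

Definition minimals A : {set B} :=
  [set m in A | [forall z in A, ~~ (z < m)]].

Definition unique_minimal A z : bool := minimals A == [set z].

Definition is_bottom z : bool := unique_minimal [set: B] z.

Definition lower_eulerian rho : Prop :=
  locally_eulerian rho /\ exists m, is_bottom m.

Definition hat0 (hB : exists m : B, is_bottom m) : B := xchoose hB.

Definition upset z : {set B} := [set z' | z <= z'].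

Definition is_join z z' w : bool := unique_minimal (upset z :&: upset z') w.

Definition join_admissible q : Prop := forall z, exists w, is_join z q w.

Definition join_with q (hq : join_admissible q) z : B := xchoose (hq z).

Lemma join_with_upset q (hq : join_admissible q) z : join_with hq z \in upset q.
Proof.
have /eqP/setP/(_ (join_with hq z)) := xchooseP (hq z).
by rewrite !inE eqxx => /andP[/andP[]].
Qed.

End Posets.

Section Subposets.
Context {d : Order.disp_t} {B : finPOrderType d}.

Definition subposet (A : {set B}) : Type := {x : B | x \in A}.

HB.instance Definition _ (A : {set B}) := SubFinite.on (subposet A).
HB.instance Definition _ (A : {set B}) :=
  [SubChoice_isSubPOrder of subposet A by <: with d].

End Subposets.

Section Subdivisions.
Context {dX dY : Order.disp_t} {X : finPOrderType dX} {Y : finPOrderType dY}.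
Implicit Types (rhoX : X -> int) (rhoY : Y -> int) (sigma : X -> Y).

Definition order_preserving sigma : Prop := {homo sigma : x x' / x <= x'}.

Definition rank_increasing rhoX rhoY sigma : Prop :=
  forall x, (rhoX x <= rhoY (sigma x))%R.

Definition strongly_surjective rhoX rhoY sigma : Prop :=
  (forall y, exists x, sigma x = y) /\
  forall x y, sigma x <= y ->
    exists x', [/\ x <= x', rhoX x' = rhoY y & sigma x' = y].

Definition strong_formal_subdivision rhoX rhoY sigma : Prop :=
  [/\ order_preserving sigma, rank_increasing rhoX rhoY sigma,
      strongly_surjective rhoX rhoY sigma
    & forall x y, sigma x <= y ->
        (\sum_(x' : X | (x <= x')%O && (sigma x' == y))
            (-1 : int) ^ (rhoY y - rhoX x') = 1)%R].

Definition poset_iso (f : X -> Y) : Prop :=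
  bijective f /\ {mono f : x x' / x <= x'}.

End Subdivisions.

Section Cylinder.
Context {dX dY : Order.disp_t} {X : finPOrderType dX} {Y : finPOrderType dY}.
Context {sigma : X -> Y}.

(* Monotonicity of sigma is a parameter because transitivity needs it. *)
Definition Cyl (hs : order_preserving sigma) : Type := (X + Y)%type.

Variable hs : order_preserving sigma.

HB.instance Definition _ := Finite.on (Cyl hs).

Definition cyl_le (z z' : Cyl hs) : bool :=
  match z, z' with
  | inl x, inl x' => x <= x'
  | inr y, inr y' => y <= y'
  | inl x, inr y  => sigma x <= y
  | inr _, inl _  => false
  end.

Fact cyl_le_refl : reflexive cyl_le.
Proof. by case=> z /=. Qed.

Fact cyl_le_anti : antisymmetric cyl_le.
Proof.
by case=> [x|y] [x'|y'] /=; rewrite ?andbF // => /le_anti ->.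
Qed.

Fact cyl_le_trans : transitive cyl_le.
Proof.
case=> [x|y] [x'|y'] [x''|y''] //=; try exact: le_trans.
by move=> /hs; apply: le_trans.
Qed.

HB.instance Definition _ :=
  Order.Le_isPOrder.Build dY (Cyl hs) cyl_le_refl cyl_le_anti cyl_le_trans.

Definition cyl_rank (rhoX : X -> int) (rhoY : Y -> int) (z : Cyl hs) : int :=
  match z with
  | inl x => rhoX x
  | inr y => (rhoY y + 1)%R
  end.

End Cylinder.

Record subdiv_data := SubdivData {
  sd_dispX : Order.disp_t;
  sd_dispY : Order.disp_t;
  sd_X : finPOrderType sd_dispX;
  sd_Y : finPOrderType sd_dispY;
  sd_rhoX : sd_X -> int;
  sd_rhoY : sd_Y -> int;
  sd_map : sd_X -> sd_Y }.

Definition is_subdiv (s : subdiv_data) : Prop :=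
  [/\ lower_eulerian (@sd_rhoX s), lower_eulerian (@sd_rhoY s)
    & strong_formal_subdivision (@sd_rhoX s) (@sd_rhoY s) (@sd_map s)].

Record Subdiv := MkSubdiv {
  subdiv_val :> subdiv_data;
  subdivP : is_subdiv subdiv_val }.

Record pointed_data := PointedData {
  pd_disp : Order.disp_t;
  pd_poset : finPOrderType pd_disp;
  pd_rho : pd_poset -> int;
  pd_q : pd_poset }.

Definition is_join_adm (g : pointed_data) : Prop :=
  [/\ lower_eulerian (@pd_rho g), join_admissible (pd_q g)
    & ~ is_bottom (pd_q g)].

Record JoinAdm := MkJoinAdm {
  join_adm_val :> pointed_data;
  join_admP : is_join_adm join_adm_val }.

Definition subdiv_mono (s : Subdiv) : order_preserving (@sd_map s) :=
  let: And3 _ _ (And4 h _ _ _) := subdivP s in h.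
Arguments subdiv_mono : clear implicits.

Definition subdiv_bottomY (s : Subdiv) : exists m : sd_Y s, is_bottom m :=
  let: And3 _ (conj _ h) _ := subdivP s in h.

Definition join_adm_q (g : JoinAdm) : join_admissible (pd_q g) :=
  let: And3 _ h _ := join_admP g in h.
Arguments join_adm_q : clear implicits.

Definition CYL_data (s : Subdiv) : pointed_data :=
  @PointedData _ (Cyl (subdiv_mono s))
    (cyl_rank (@sd_rhoX s) (@sd_rhoY s))
    (inr (hat0 (subdiv_bottomY s))).

Definition MAP_data (g : JoinAdm) : subdiv_data :=
  @SubdivData _ _
    (subposet (~: upset (pd_q g))) (subposet (upset (pd_q g)))
    (fun x => pd_rho (val x))
    (fun y => (pd_rho (val y) - 1)%R)
    (fun x => exist _ (join_with (join_adm_q g) (val x))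
                      (join_with_upset (join_adm_q g) (val x))).

(* Isomorphic posets are identified in the mathematics; the carriers here are
   types, so that identification is expressed by explicit isomorphisms. *)
Definition subdiv_iso (s s' : subdiv_data)
    (f : sd_X s -> sd_X s') (h : sd_Y s -> sd_Y s') : Prop :=
  [/\ poset_iso f, poset_iso h,
      forall x, sd_rhoX (f x) = sd_rhoX x,
      forall y, sd_rhoY (h y) = sd_rhoY y
    & forall x, sd_map (f x) = h (sd_map x)].

Definition subdiv_isomorphic (s s' : subdiv_data) : Prop :=
  exists (f : sd_X s -> sd_X s') (h : sd_Y s -> sd_Y s'), subdiv_iso f h.

Definition pointed_iso (g g' : pointed_data)
    (f : pd_poset g -> pd_poset g') : Prop :=
  [/\ poset_iso f, forall z, pd_rho (f z) = pd_rho z & f (pd_q g) = pd_q g'].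

Definition pointed_isomorphic (g g' : pointed_data) : Prop :=
  exists f : pd_poset g -> pd_poset g', pointed_iso f.

(* Main.v *)
Require Import Defs.
From mathcomp Require Import all_boot all_order all_algebra.

Set Implicit Arguments.
Unset Strict Implicit.
Unset Printing Implicit Defensive.

Import Order.TTheory GRing.Theory Num.Theory.

Local Open Scope order_scope.

(** Everything rests on one cancellation.

    Let [sigma : X -> Y] be order preserving and let [x] in [X] lie below [y] in
    [Y] inside the mapping cylinder. The alternating sum over [[x, y]] consists
    of the terms of the elements [y'] of [Y] between [sigma x] and [y], and of
    the elements of [X] above [x], which may be grouped into the fibres of
    [sigma] over those same [y']. As ranks on [Y] are raised by one in the
    cylinder, the fibre condition of a strong formal subdivision says exactly
    that each fibre cancels the term of its image. This makes the cylinder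
    locally Eulerian ([cyl_mixed_interval]); strong surjectivity supplies the
    rank condition for coverings that go from [X] to [Y] ([cyl_rank_function]).
    The part [Y] is the principal upper set of its bottom, and the join of [x]
    with that bottom is [sigma x] ([cyl_is_join]).

    Conversely, for a join-admissible [q] the map [x |-> x \/ q] makes the same
    grouping available in any lower Eulerian poset. There the interval sums
    are known to vanish, and an induction on [y] recovers the fibre condition
    ([join_fibre_sum]). In particular no fibre is empty, and a maximal element
    of a fibre over [y] is a coatom of [y], which gives strong surjectivity
    ([join_lift]).

    The underlying sets of both round trips are canonically the original ones,
    because a join with [q] is determined by its upper bounds ([MAP_CYL],
    [CYL_MAP]). Both constructions carry isomorphisms to isomorphisms, so the
    round trips also show that they reflect isomorphism. *)

(** * Induction and extremal elements in finite posets *)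

Lemma fin_lt_ind (d : Order.disp_t) (B : finPOrderType d) (P : B -> Prop) :
  (forall y, (forall t, t < y -> P t) -> P y) -> forall y, P y.
Proof.
move=> step y; have [n] := ubnP #|[set t : B | t < y]|.
elim: n y => // n IHn y; rewrite ltnS => le_n; apply: step => t lt_ty.
apply: IHn; apply: leq_trans le_n; apply/proper_card/properP; split.
  by apply/subsetP=> u; rewrite !inE => /lt_trans; apply.
by exists t; rewrite inE ?ltxx.
Qed.

Lemma minimal_below (d : Order.disp_t) (B : finPOrderType d) (P : pred B) x :
  P x -> exists m, [/\ P m, m <= x & forall t, t < m -> ~~ P t].
Proof.
elim/fin_lt_ind: x => x IHx Px.
have [t /andP[lt_tx Pt]|noP] := pickP (fun t => (t < x) && P t).
  have [m [Pm le_mt minm]] := IHx t lt_tx Pt.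
  by exists m; split=> //; apply/(le_trans le_mt)/ltW.
by exists x; split=> // t lt_tx; move: (noP t); rewrite /= lt_tx /= => ->.
Qed.

Lemma maximal_above (d : Order.disp_t) (B : finPOrderType d) (P : pred B) x :
  P x -> exists m, [/\ P m, x <= m & forall t, m < t -> ~~ P t].
Proof. by move=> Px; have := @minimal_below _ B^d P x Px. Qed.

Section Minimum.
Context {d : Order.disp_t} {B : finPOrderType d}.
Implicit Types (z q w : B) (A : {set B}).

(** By finiteness every element of [A] lies above a minimal element of [A], so
    a unique minimal element is a minimum. *)
Lemma unique_minimalP A z :
  reflect (z \in A /\ forall t, t \in A -> z <= t) (unique_minimal A z).
Proof.
apply: (iffP eqP) => [minA|[zA zmin]].
  have inmin t : (t \in minimals A) = (t == z) by rewrite minA inE.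
  split=> [|t tA]; first by have := inmin z; rewrite eqxx inE => /andP[].
  have [m [mA le_mt minm]] := @minimal_below _ _ (fun u => u \in A) t tA.
  suff /eqP <- : m == z by [].
  rewrite -inmin inE mA; apply/forall_inP=> u uA.
  by apply/negP=> /minm /negP[].
apply/setP=> t; rewrite !inE; apply/andP/eqP => [[tA /forall_inP mint]|->].
  by have := zmin t tA; rewrite le_eqVlt (negbTE (mint z zA)) orbF => /eqP.
split=> //; apply/forall_inP=> u uA.
by apply/negP=> lt_uz; have := lt_le_trans lt_uz (zmin u uA); rewrite ltxx.
Qed.

Lemma is_bottomP z : reflect (forall t, z <= t) (is_bottom z).
Proof.
apply: (iffP (unique_minimalP _ _)) => [[_ zmin] t|zmin]; first exact: zmin.
by split.
Qed.

Lemma hat0_le (hB : exists m : B, is_bottom m) t : hat0 hB <= t.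
Proof. exact: (is_bottomP _ (xchooseP hB)). Qed.

Lemma hat0_uniq (hB : exists m : B, is_bottom m) z :
  (forall t, z <= t) -> hat0 hB = z.
Proof. by move=> zle; apply: le_anti; rewrite hat0_le zle. Qed.

(** A least upper bound is determined by its principal upper set; this
    equational form lets comparisons with a join be rewritten. *)
Lemma is_joinP z q w :
  reflect (forall t, (w <= t) = (z <= t) && (q <= t)) (is_join z q w).
Proof.
apply: (iffP (unique_minimalP _ _)); rewrite !inE.
  case=> /andP[le_zw le_qw] wmin t; apply/idP/andP=> [le_wt|[le_zt le_qt]].
    by split; [apply: le_trans le_wt | apply: le_trans le_wt].
  by apply: wmin; rewrite !inE le_zt.
move=> wE; rewrite -wE lexx; split=> // t.
by rewrite !inE wE.
Qed.

Lemma join_with_le q (hq : join_admissible q) z t :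
  (join_with hq z <= t) = (z <= t) && (q <= t).
Proof. exact: (is_joinP _ _ _ (xchooseP (hq z))). Qed.

Lemma join_with_uniq q (hq : join_admissible q) z w :
  (forall t, (w <= t) = (z <= t) && (q <= t)) -> join_with hq z = w.
Proof.
by move=> wE; apply: le_anti; rewrite join_with_le -wE lexx wE -join_with_le /=.
Qed.

Lemma join_with_ub q (hq : join_admissible q) z :
  (z <= join_with hq z) && (q <= join_with hq z).
Proof. by rewrite -join_with_le. Qed.

End Minimum.

(** * Rank functions and alternating sums over intervals *)

Lemma signzD (m n : int) : ((-1 : int) ^ (m + n) = (-1) ^ m * (-1) ^ n)%R.
Proof. exact: exprzDr. Qed.

Lemma signzB (m n : int) : ((-1 : int) ^ (m - n) = (-1) ^ m * (-1) ^ n)%R.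
Proof. by rewrite signzD -exprz_inv invrN1. Qed.

Lemma signz_sqr (n : int) : ((-1 : int) ^ n * (-1) ^ n = 1)%R.
Proof. by rewrite -signzB subrr. Qed.

Section Rank.
Context {d : Order.disp_t} {B : finPOrderType d}.
Implicit Types (z w : B) (rho : B -> int).

(** An interval of a finite poset is either a covering or can be cut at an
    interior point, and both halves are then smaller. *)
Lemma rank_function_lt rho z z' :
  rank_function rho -> z < z' -> (rho z < rho z')%R.
Proof.
move=> [_ rhoS]; have [n] := ubnP #|[set t | z < t < z']|.
elim: n z z' => // n IHn z z'; rewrite ltnS => le_n lt_zz'.
have [t /andP[lt_zt lt_tz']|noT] := pickP (fun t => z < t < z').
  apply: (@lt_trans _ _ (rho t)); apply: IHn => //; apply: leq_trans le_n.
    apply/proper_card/properP; split; last first.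
      by exists t; rewrite inE ?ltxx ?andbF ?lt_zt.
    apply/subsetP=> u; rewrite !inE => /andP[-> lt_ut].
    exact: lt_trans lt_tz'.
  apply/proper_card/properP; split; last first.
    by exists t; rewrite inE ?ltxx ?lt_zt.
  apply/subsetP=> u; rewrite !inE => /andP[lt_tu ->].
  by rewrite (lt_trans lt_zt).
by rewrite (rhoS z z') ?ltrDl //; split=> // t; rewrite noT.
Qed.

(** Only the term at [y] survives once the terms strictly below it are known to
    vanish. *)
Lemma interval_sums_eq0 (w : B) (G : B -> int) :
  (forall y, w <= y -> (\sum_(t | (w <= t <= y)%O) G t = 0)%R) ->
  forall y, w <= y -> G y = 0%R.
Proof.
move=> sum0; elim/fin_lt_ind=> y IHy le_wy.
have := sum0 y le_wy; rewrite (bigD1 y) ?le_wy ?lexx //= big1 ?addr0 //.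
move=> t /andP[/andP[le_wt le_ty] ne_ty].
by apply: IHy => //; rewrite lt_neqAle ne_ty.
Qed.

End Rank.

Section ConvexEmbedding.
Context {dA dB : Order.disp_t} {A : finPOrderType dA} {B : finPOrderType dB}.
Variable j : A -> B.

(** Both the two parts of a mapping cylinder and the two parts of a poset cut by
    a principal upper set are embedded in this way. *)
Definition convex_embedding : Prop :=
  {mono j : a a' / a <= a'} /\
  forall a a' b, j a <= b <= j a' -> exists c, b = j c.

Hypothesis j_convex : convex_embedding.

Let j_mono := j_convex.1.

Lemma convex_lt a a' : (j a < j a') = (a < a').
Proof. exact: leW_mono. Qed.

Lemma covers_convex a a' : covers (j a') (j a) <-> covers a' a.
Proof.
split=> [[lt_aa' no]|[lt_aa' no]]; split.
- by rewrite -convex_lt.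
- by move=> t; have := no (j t); rewrite !convex_lt.
- by rewrite convex_lt.
move=> t /[dup] /andP[lt_at lt_ta'].
have [|c ->] := j_convex.2 a a' t; first by rewrite !ltW.
by rewrite !convex_lt; apply: no.
Qed.

Lemma sum_interval_convex (F : B -> int) a a' :
  (\sum_(t | (j a <= t <= j a')%O) F t =
   \sum_(t | (a <= t <= a')%O) F (j t))%R.
Proof.
have j_inj : injective j := inc_inj j_mono.
have sE t : (j a <= t <= j a') = (t \in j @: [set c | a <= c <= a']).
  apply/idP/imsetP=> [Ht|[c + ->]]; last by rewrite inE !j_mono.
  have [c tE] := j_convex.2 _ _ _ Ht; exists c => //.
  by move: Ht; rewrite tE inE !j_mono.
rewrite (eq_bigl _ _ sE) big_imset => [|c c' _ _ /j_inj //].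
by apply: eq_bigl => c; rewrite inE.
Qed.

(** A convex subposet has the same covering relations and the same intervals as
    the ambient poset; shifting the ranks multiplies every alternating sum by a
    sign. *)
Lemma locally_eulerian_convex (rho : B -> int) (rhoA : A -> int) (k : int) :
  (forall a, rhoA a = rho (j a) + k)%R -> (0 < #|A|)%N ->
  locally_eulerian rho -> locally_eulerian rhoA.
Proof.
move=> rhoAE A_gt0 [[_ rhoS] rho0]; split.
  split=> // a a' /covers_convex /rhoS; rewrite !rhoAE => ->.
  by rewrite addrAC.
move=> a a' lt_aa'.
under eq_bigr => t _ do rewrite rhoAE signzD.
rewrite -big_distrl -(sum_interval_convex (fun t => (-1) ^ rho t)%R) /=.
by rewrite rho0 ?mul0r // convex_lt.
Qed.

End ConvexEmbedding.

(** * The mapping cylinder of a strong formal subdivision *)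

Section CylinderOfSubdivision.
Context {dX dY : Order.disp_t} {X : finPOrderType dX} {Y : finPOrderType dY}.
Context {rhoX : X -> int} {rhoY : Y -> int} {sigma : X -> Y}.
Hypothesis sigma_mono : order_preserving sigma.

Local Notation Gamma := (Cyl sigma_mono).
Local Notation inX x := (inl x : Gamma).
Local Notation inY y := (inr y : Gamma).
Local Notation rho := (@cyl_rank _ _ _ _ _ sigma_mono rhoX rhoY).

Lemma inl_convex : convex_embedding (fun x => inX x).
Proof. by split=> // a a' [x|y]; [exists x | rewrite andbF]. Qed.

Lemma inr_convex : convex_embedding (fun y => inY y).
Proof. by split=> // a a' [x|y] // _; exists y. Qed.

Hypothesis rhoX_lower : lower_eulerian rhoX.
Hypothesis rhoY_lower : lower_eulerian rhoY.
Hypothesis sigma_subdiv : strong_formal_subdivision rhoX rhoY sigma.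

(** When [x] in [X] is covered by [y'] in [Y], the lift of [y'] above [x] of
    rank [rhoY y'] lies between [x] and [y'] in the cylinder, so it is [x]. *)
Lemma cyl_rank_function : rank_function rho.
Proof.
have [[[[X_gt0 rhoX_S] _] _] [[[_ rhoY_S] _] _]] := (rhoX_lower, rhoY_lower).
have [_ _ [_ lift] _] := sigma_subdiv.
split; first by have /card_gt0P[x _] := X_gt0; apply/card_gt0P; exists (inX x).
case=> [x|y] [x'|y'] cov; first 1 last.
- have [lt_xy no] := cov.
  have [x' [le_xx' rho_x' sx']] := lift x y' (ltW lt_xy).
  suff -> : x = x' by rewrite /= rho_x'.
  apply/eqP; have [//|ne_xx'] := eqVneq x x'.
  case: (no (inX x')); apply/andP.
  split; rewrite lt_neqAle; apply/andP; split=> //.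
  by rewrite /Order.le /= sx'.
- by case: cov.
- by rewrite /= (rhoY_S y) //; apply/(covers_convex inr_convex).
by apply: rhoX_S; apply/(covers_convex inl_convex).
Qed.

(** Grouping the elements of [X] in the interval by their image, the fibre over
    [y'] contributes the sign of [y'], which cancels the term of [y'] itself
    because the ranks on [Y] are raised by one. *)
Lemma cyl_mixed_interval x y :
  (\sum_(t : Gamma | (inX x <= t <= inY y)%O) (-1 : int) ^ rho t = 0)%R.
Proof.
have [_ _ _ fibre1] := sigma_subdiv; rewrite big_sumType /=.
rewrite (partition_big sigma (fun y' => sigma x <= y' <= y)) /=; last first.
  by move=> x' /andP[/sigma_mono sxx' sx'y]; apply/andP.
rewrite -big_split big1 //= => y' /andP[le_xy' le_y'y].
rewrite signzD expr1z mulrN1; apply/eqP; rewrite subr_eq0; apply/eqP.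
rewrite -[RHS]mulr1 -[in X in (_ * X)%R](fibre1 x y' le_xy') big_distrr /=.
apply: eq_big => x'.
  rewrite -andbA; congr (_ && _).
  by apply: andb_idl => /eqP sx'; change (sigma x' <= y); rewrite sx'.
by move=> _; rewrite signzB mulrA signz_sqr mul1r.
Qed.

Lemma cyl_lower_eulerian : lower_eulerian rho.
Proof.
have [[[_ sumX] [m mbot]] [[_ sumY] _]] := (rhoX_lower, rhoY_lower).
have [_ _ [onto _] _] := sigma_subdiv; have {mbot}mle := is_bottomP _ mbot.
split; last first.
  exists (inX m); apply/is_bottomP => -[x|y]; first exact: mle.
  by have [x <-] := onto y; apply/sigma_mono/mle.
split; first exact: cyl_rank_function.
case=> [x|y] [x'|y'] lt_zz'; first 1 last.
- exact: cyl_mixed_interval.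
- by [].
- have := sum_interval_convex inr_convex (fun t => (-1) ^ rho t)%R y y'.
  move=> /= ->.
  under eq_bigr do rewrite signzD.
  by rewrite -big_distrl /= sumY ?mul0r -?(convex_lt inr_convex).
have := sum_interval_convex inl_convex (fun t => (-1) ^ rho t)%R x x'.
by move=> /= ->; apply: sumX; rewrite -(convex_lt inl_convex).
Qed.

Lemma cyl_upset_hat0 (hY : exists m : Y, is_bottom m) (z : Gamma) :
  (z \in upset (inY (hat0 hY))) = if z is inr _ then true else false.
Proof. by rewrite inE; case: z => // y; apply: hat0_le. Qed.

(** Above an element of [X] the part [Y] of the cylinder is the principal upper
    set of its image, so the join of [x] with the bottom of [Y] is [sigma x]. *)
Lemma cyl_is_join (hY : exists m : Y, is_bottom m) (z : Gamma) :
  is_join z (inY (hat0 hY))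
    (inY (match z with inl x => sigma x | inr y => y end)).
Proof.
apply/is_joinP=> t; have := cyl_upset_hat0 hY t; rewrite inE => ->.
by case: t; case: z => [a|a] b; rewrite ?andbT ?andbF.
Qed.

Lemma cyl_is_join_adm (hY : exists m : Y, is_bottom m) :
  is_join_adm (PointedData rho (inY (hat0 hY))).
Proof.
split=> /=; first exact: cyl_lower_eulerian.
- by move=> z; eexists; apply: cyl_is_join.
have [[[[/card_gt0P[x _] _] _] _]] := rhoX_lower.
by move=> /is_bottomP/(_ (inX x)).
Qed.

End CylinderOfSubdivision.

(** * The subdivision defined by a join-admissible element *)

Section SubdivisionOfJoin.
Context {d : Order.disp_t} {Gamma : finPOrderType d}.
Context {rho : Gamma -> int} {q : Gamma}.
Hypothesis rho_lower : lower_eulerian rho.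
Hypothesis q_adm : join_admissible q.
Hypothesis q_nbot : ~ is_bottom q.

Local Notation X := (subposet (~: upset q)).
Local Notation Y := (subposet (upset q)).
Local Notation rhoX := (fun x : X => rho (val x)).
Local Notation rhoY := (fun y : Y => rho (val y) - 1)%R.
Local Notation join := (join_with q_adm).
Local Notation sigma :=
  (fun x : X => exist _ (join (val x)) (join_with_upset q_adm (val x)) : Y).

Let rho_rank : rank_function rho := rho_lower.1.1.

Lemma inXP (x : X) : ~~ (q <= val x).
Proof. by have := valP x; rewrite !inE. Qed.

Lemma inYP (y : Y) : q <= val y.
Proof. by have := valP y; rewrite inE. Qed.

Lemma lower_convex : convex_embedding (val : X -> Gamma).
Proof.
split=> // a a' b /andP[_ le_ba'].
have bX : b \in ~: upset q.
  by rewrite !inE; apply: contra (inXP a') => /le_trans; apply.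
by exists (exist _ b bX).
Qed.

Lemma upper_convex : convex_embedding (val : Y -> Gamma).
Proof.
split=> // a a' b /andP[le_ab _].
have bY : b \in upset q by rewrite inE (le_trans (inYP a)).
by exists (exist _ b bY).
Qed.

(** A bottom above [q] would force [q] to be a bottom itself. *)
Lemma bottom_not_above :
  exists2 m, m \in ~: upset q & forall t : Gamma, m <= t.
Proof.
have [_ [m /is_bottomP mle]] := rho_lower; exists m => //.
rewrite !inE; apply/negP=> le_qm; apply: q_nbot; apply/is_bottomP=> t.
exact: le_trans (mle t).
Qed.

Lemma lower_lower_eulerian : lower_eulerian rhoX.
Proof.
have [[rho_euler _] [m mX mle]] := (rho_lower, bottom_not_above).
split; last by exists (exist _ m mX); apply/is_bottomP=> t; apply: mle.
apply: (locally_eulerian_convex lower_convex (k := 0%R)) rho_euler => [a|].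
  by rewrite addr0.
by apply/card_gt0P; exists (exist _ m mX).
Qed.

Lemma upper_lower_eulerian : lower_eulerian rhoY.
Proof.
have [rho_euler _] := rho_lower.
have qY : q \in upset q by rewrite inE.
split; last by exists (exist _ q qY); apply/is_bottomP=> t; apply: inYP.
apply: (locally_eulerian_convex upper_convex (k := - 1)%R) rho_euler => //.
by apply/card_gt0P; exists (exist _ q qY).
Qed.

Lemma join_map_mono : order_preserving sigma.
Proof.
move=> x x' le_xx'; change (join (val x) <= join (val x')).
have /andP[le_x'j le_qj] := join_with_ub q_adm (val x').
by rewrite join_with_le le_qj andbT (le_trans _ le_x'j).
Qed.

(** The interval [[x, y]] splits into the interval [[x \/ q, y]] and the
    elements not above [q], which are grouped by their join with [q]. As the
    alternating sum over [[x, y]] vanishes for every [y] above [x \/ q], so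
    does, by induction on [y], the sum of the term of [y] and of its fibre. *)
Lemma join_fibre_sum x : ~~ (q <= x) -> forall y, join x <= y ->
  (\sum_(t | [&& x <= t, ~~ (q <= t) & join t == y]%O) (-1 : int) ^ rho t
   = - (-1) ^ rho y)%R.
Proof.
move=> x_nge y le_xy; apply/eqP; rewrite -addr_eq0; apply/eqP.
pose F z := (\sum_(t | [&& x <= t, ~~ (q <= t) & join t == z]%O)
               (-1 : int) ^ rho t + (-1) ^ rho z)%R.
apply: (interval_sums_eq0 (w := join x) (G := F)) le_xy => {}y le_xy.
have /andP[le_xj le_qj] := join_with_ub q_adm x.
have lt_xy : x < y.
  rewrite lt_neqAle (le_trans le_xj le_xy) andbT; apply: contraNneq x_nge => ->.
  exact: le_trans le_xy.
rewrite -[RHS](rho_lower.1.2 x y lt_xy) /F big_split /=.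
(* Being above both [x] and [q] means being above their join. *)
rewrite [RHS](bigID (fun t => q <= t)) /= addrC; congr (_ + _)%R.
  by apply: eq_bigl => t; rewrite join_with_le andbAC.
rewrite [RHS](partition_big join (fun z => join x <= z <= y)) /=; last first.
  move=> t /andP[/andP[le_xt le_ty] _].
  have /andP[le_tj le_qtj] := join_with_ub q_adm t.
  by rewrite !join_with_le le_qtj le_ty (le_trans le_xt) // (le_trans le_qj).
apply: eq_bigr => z /andP[_ le_zy]; apply: eq_bigl => t.
rewrite -!andbA; congr (_ && _).
apply/idP/and3P=> [/andP[-> /eqP jtz]|[_ -> ->]] //; split=> //; last exact/eqP.
have /andP[le_tj _] := join_with_ub q_adm t.
by apply: le_trans le_zy; rewrite -jtz.
Qed.

(** The fibre over [y] is nonempty since its alternating sum is a unit, and a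
    maximal element of it is a coatom of [y]: anything strictly between would
    either lie in the same fibre or lie above its own join [y]. *)
Lemma join_lift x y : ~~ (q <= x) -> join x <= y ->
  exists x', [/\ x <= x', ~~ (q <= x'), join x' = y & rho x' = (rho y - 1)%R].
Proof.
move=> x_nge le_xy; pose P t := [&& x <= t, ~~ (q <= t) & join t == y].
have [t0 Pt0|noP] := pickP P; last first.
  have := join_fibre_sum x_nge le_xy; rewrite big_pred0 // => /esym/eqP.
  by rewrite oppr_eq0 => /eqP E; have := signz_sqr (rho y); rewrite E mul0r.
have [x' [/and3P[le_xx' x'_nge /eqP jx'] _ maxx']] := maximal_above Pt0.
exists x'; split=> //; have [_ rhoS] := rho_rank.
have /andP[le_x'j le_qj] := join_with_ub q_adm x'; rewrite jx' in le_x'j le_qj.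
rewrite (rhoS x' y) ?addrK //; split=> [|t /andP[lt_x't lt_ty]].
  by rewrite lt_neqAle le_x'j andbT; apply: contraNneq x'_nge => ->.
have [le_qt|t_nge] := boolP (q <= t).
  have : join x' <= t by rewrite join_with_le (ltW lt_x't).
  by rewrite jx' => /(lt_le_trans lt_ty); rewrite ltxx.
have /negP[] := maxx' t lt_x't.
rewrite /P t_nge (le_trans le_xx' (ltW lt_x't)) /=.
have /andP[le_tj le_qtj] := join_with_ub q_adm t.
rewrite eq_le join_with_le (ltW lt_ty) le_qj /= -jx' join_with_le le_qtj andbT.
exact: le_trans (ltW lt_x't) le_tj.
Qed.

Lemma join_strong_formal_subdivision :
  strong_formal_subdivision rhoX rhoY sigma.
Proof.
have lift (x : X) (y : Y) : sigma x <= y ->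
    exists x' : X, [/\ x <= x', rhoX x' = rhoY y & sigma x' = y].
  move=> le_xy; have [t [le_xt t_nge jt rt]] := join_lift (inXP x) le_xy.
  have tX : t \in ~: upset q by rewrite !inE.
  by exists (exist _ t tX); split=> //; apply: val_inj.
split=> //.
- exact: join_map_mono.
- move=> x; have /andP[le_xj le_qj] := join_with_ub q_adm (val x).
  have : val x < join (val x).
    by rewrite lt_neqAle le_xj andbT; apply: contraNneq (inXP x) => ->.
  by move/(rank_function_lt rho_rank); rewrite -ltzD1 /= subrK.
- (* The bottom of the poset has join [q], hence lifts every [y]. *)
  split=> // y; have [m mX mle] := bottom_not_above.
  have [|x [_ _ sx]] := lift (exist _ m mX) y; last by exists x.
  by change (join m <= val y); rewrite join_with_le mle inYP.
move=> x y le_xy; under eq_bigr => t _ do rewrite 2!signzB expr1z.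
rewrite -big_distrr /=.
rewrite -(big_sub_cond (mem (~: upset q))
  (fun t => (val x <= t) && (join t == val y)) (fun t => (-1) ^ rho t)%R) /=.
under eq_bigl => t do rewrite !inE andbCA.
by rewrite (join_fibre_sum (inXP x) le_xy) mulrN1 mulrNN signz_sqr.
Qed.

End SubdivisionOfJoin.

(** * Isomorphisms of posets and of the two kinds of data *)

Section PosetIso.
Context {dX dY : Order.disp_t} {X : finPOrderType dX} {Y : finPOrderType dY}.

(** Reflecting the order already gives injectivity. *)
Lemma poset_iso_onto (f : X -> Y) :
  {mono f : x x' / x <= x'} -> (forall y, exists x, f x = y) -> poset_iso f.
Proof.
move=> f_mono f_onto; split=> //.
have f_ontob y : exists x, f x == y by have [x <-] := f_onto y; exists x.
have gK : cancel (fun y => xchoose (f_ontob y)) f.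
  by move=> y; apply/eqP/(xchooseP (f_ontob y)).
by exists (fun y => xchoose (f_ontob y)) => // x; apply: (inc_inj f_mono).
Qed.

Lemma poset_iso_inv (f : X -> Y) :
  poset_iso f -> exists g : Y -> X, poset_iso g /\ cancel g f.
Proof.
case=> -[g fK gK] f_mono; exists g; split=> //; split; first by exists f.
by move=> y y'; rewrite -f_mono !gK.
Qed.

Lemma poset_iso_comp (dZ : Order.disp_t) (Z : finPOrderType dZ)
    (f : X -> Y) (g : Y -> Z) :
  poset_iso f -> poset_iso g -> poset_iso (g \o f).
Proof.
move=> [f_bij f_mono] [g_bij g_mono]; split; first exact: bij_comp.
by move=> x x' /=; rewrite g_mono f_mono.
Qed.

End PosetIso.

Lemma restrict_iso (dX dY : Order.disp_t) (X : finPOrderType dX)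
    (Y : finPOrderType dY) (f : X -> Y) (A : {set X}) (A' : {set Y}) :
  poset_iso f -> (forall x, (f x \in A') = (x \in A)) ->
  exists f' : subposet A -> subposet A',
    poset_iso f' /\ forall x, val (f' x) = f (val x).
Proof.
move=> fiso fA; have f'P (x : subposet A) : f (val x) \in A'.
  by rewrite fA; apply: valP.
exists (fun x => exist _ (f (val x)) (f'P x)); split=> //.
apply: poset_iso_onto => [x x'|y]; first exact: fiso.2.
have [g [_ gK]] := poset_iso_inv fiso.
have gA : g (val y) \in A by rewrite -fA gK; apply: valP.
by exists (exist _ (g (val y)) gA); apply: val_inj; apply: gK.
Qed.

Lemma subdiv_isomorphic_sym s s' :
  subdiv_isomorphic s s' -> subdiv_isomorphic s' s.
Proof.
case=> [f [h [fiso hiso fr hr fh]]].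
have [f' [f'iso f'K]] := poset_iso_inv fiso.
have [h' [h'iso h'K]] := poset_iso_inv hiso.
exists f', h'; split=> // [x|y|x].
- by rewrite -fr f'K.
- by rewrite -hr h'K.
by apply: (inc_inj hiso.2); rewrite -fh f'K h'K.
Qed.

Lemma subdiv_isomorphic_trans s s' s'' :
  subdiv_isomorphic s s' -> subdiv_isomorphic s' s'' -> subdiv_isomorphic s s''.
Proof.
case=> [f [h [fiso hiso fr hr fh]]] [f' [h' [f'iso h'iso f'r h'r f'h']]].
exists (f' \o f), (h' \o h); split=> [||x|y|x] /=.
- exact: poset_iso_comp.
- exact: poset_iso_comp.
- by rewrite f'r.
- by rewrite h'r.
by rewrite f'h' fh.
Qed.

Lemma pointed_isomorphic_sym g g' :
  pointed_isomorphic g g' -> pointed_isomorphic g' g.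
Proof.
case=> f [fiso fr fq]; have [f' [f'iso f'K]] := poset_iso_inv fiso.
exists f'; split=> // [z|]; first by rewrite -fr f'K.
by apply: (inc_inj fiso.2); rewrite f'K fq.
Qed.

Lemma pointed_isomorphic_trans g g' g'' :
  pointed_isomorphic g g' -> pointed_isomorphic g' g'' ->
  pointed_isomorphic g g''.
Proof.
case=> f [fiso fr fq] [f' [f'iso f'r f'q]]; exists (f' \o f).
split=> [|z|] /=; [exact: poset_iso_comp | by rewrite f'r | by rewrite fq].
Qed.

(** * The two constructions are mutually inverse *)

Lemma is_join_adm_CYL (s : Subdiv) : is_join_adm (CYL_data s).
Proof. by have [? ? ?] := subdivP s; apply: cyl_is_join_adm. Qed.

Lemma is_subdiv_MAP (g : JoinAdm) : is_subdiv (MAP_data g).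
Proof.
have [? ? ?] := join_admP g; split.
- exact: lower_lower_eulerian.
- exact: upper_lower_eulerian.
exact: join_strong_formal_subdivision.
Qed.

Definition CYL (s : Subdiv) : JoinAdm := MkJoinAdm (is_join_adm_CYL s).
Definition MAP (g : JoinAdm) : Subdiv := MkSubdiv (is_subdiv_MAP g).

Lemma CYL_isomorphic (s s' : Subdiv) :
  subdiv_isomorphic s s' -> pointed_isomorphic (CYL s) (CYL s').
Proof.
case=> [f [h [fiso hiso fr hr fh]]].
pose F (z : Cyl (subdiv_mono s)) : Cyl (subdiv_mono s') :=
  match z with inl x => inl (f x) | inr y => inr (h y) end.
exists F; split=> [|[x|y]|] /=; last 1 first.
- rewrite /F; congr inr; apply/esym/hat0_uniq.
  have [h' [[_ h'mono] h'K]] := poset_iso_inv hiso.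
  by move=> t; rewrite -(h'K t) hiso.2 hat0_le.
- apply: poset_iso_onto => [[x|y] [x'|y']|[x'|y']].
  + exact: fiso.2.
  + by change ((sd_map (f x) <= h y') = (sd_map x <= y')); rewrite fh hiso.2.
  + by [].
  + exact: hiso.2.
  + have [f' [_ f'K]] := poset_iso_inv fiso.
    by exists (inl (f' x')); rewrite /F f'K.
  have [h' [_ h'K]] := poset_iso_inv hiso.
  by exists (inr (h' y')); rewrite /F h'K.
- by rewrite fr.
by rewrite hr.
Qed.

Lemma join_with_iso (d d' : Order.disp_t) (B : finPOrderType d)
    (B' : finPOrderType d') (q : B) (q' : B') (hq : join_admissible q)
    (hq' : join_admissible q') (f : B -> B') z :
  poset_iso f -> f q = q' -> join_with hq' (f z) = f (join_with hq z).
Proof.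
move=> fiso fq; have [f' [_ f'K]] := poset_iso_inv fiso.
apply: join_with_uniq => t.
by rewrite -(f'K t) -fq !fiso.2 join_with_le.
Qed.

Lemma MAP_isomorphic (g g' : JoinAdm) :
  pointed_isomorphic g g' -> subdiv_isomorphic (MAP g) (MAP g').
Proof.
case=> f [fiso fr fq].
have fY z : (f z \in upset (pd_q g')) = (z \in upset (pd_q g)).
  by rewrite !inE -fq fiso.2.
have fX z : (f z \in ~: upset (pd_q g')) = (z \in ~: upset (pd_q g)).
  by rewrite !in_setC fY.
have [fx [fxiso fxE]] := restrict_iso fiso fX.
have [fy [fyiso fyE]] := restrict_iso fiso fY.
exists fx, fy; split=> // [x|y|x] /=.
- by rewrite fxE fr.
- by rewrite fyE fr.
by apply: val_inj; rewrite fyE /= fxE; apply: join_with_iso.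
Qed.

Lemma MAP_CYL (s : Subdiv) :
  exists (f : sd_X s -> sd_X (MAP (CYL s))) (h : sd_Y s -> sd_Y (MAP (CYL s))),
    [/\ subdiv_iso f h,
        forall x : sd_X s, val (f x) = inl x :> Cyl (subdiv_mono s)
      & forall y : sd_Y s, val (h y) = inr y :> Cyl (subdiv_mono s)].
Proof.
pose hY := subdiv_bottomY s.
have inX x : (inl x : Cyl (subdiv_mono s)) \in ~: upset (pd_q (CYL s)).
  by rewrite in_setC (cyl_upset_hat0 hY).
have inY y : (inr y : Cyl (subdiv_mono s)) \in upset (pd_q (CYL s)).
  by rewrite (cyl_upset_hat0 hY).
exists (fun x => exist _ (inl x : Cyl (subdiv_mono s)) (inX x)),
       (fun y => exist _ (inr y : Cyl (subdiv_mono s)) (inY y)).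
split=> //; split=> //.
- apply: poset_iso_onto => // -[[x|y] zX].
    by exists x; apply: val_inj.
  by have := zX; rewrite in_setC (cyl_upset_hat0 hY).
- apply: poset_iso_onto => // -[[x|y] zY].
    by have := zY; rewrite (cyl_upset_hat0 hY).
  by exists y; apply: val_inj.
- by move=> y; rewrite /= addrK.
move=> x; apply: val_inj; apply: join_with_uniq.
exact/is_joinP/(cyl_is_join hY (inl x)).
Qed.

Lemma CYL_MAP (g : JoinAdm) :
  exists f : pd_poset (CYL (MAP g)) -> pd_poset g,
    [/\ pointed_iso f,
        forall x : sd_X (MAP g),
          f (inl x : Cyl (subdiv_mono (MAP g))) = val x
      & forall y : sd_Y (MAP g),
          f (inr y : Cyl (subdiv_mono (MAP g))) = val y].
Proof.
pose f (z : Cyl (subdiv_mono (MAP g))) : pd_poset g :=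
  match z with inl x => val x | inr y => val y end.
have qY : pd_q g \in upset (pd_q g) by rewrite inE.
exists f; split=> //; split.
- apply: poset_iso_onto => [[x|y] [x'|y']|z] //.
  + change ((val x <= val y') = (join_with (join_adm_q g) (val x) <= val y')).
    by rewrite join_with_le inYP andbT.
  + change ((val y <= val x') = false); apply/negP=> le_yx'.
    by have /negP[] := inXP x'; apply: le_trans le_yx'; apply: inYP.
  have [zY|zX] := boolP (z \in upset (pd_q g)).
    by exists (inr (exist _ z zY)).
  by rewrite -in_setC in zX; exists (inl (exist _ z zX)).
- by case=> [x|y] //=; rewrite subrK.
pose q : sd_Y (MAP g) := exist _ (pd_q g) qY.
suff qE : hat0 (subdiv_bottomY (MAP g)) = q by rewrite /= qE.
by apply: hat0_uniq => t; apply: inYP.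
Qed.

Theorem theorem1p1 :
  exists (cylP : forall s : Subdiv, is_join_adm (CYL_data s))
         (mapP : forall g : JoinAdm, is_subdiv (MAP_data g)),
  let CYL (s : Subdiv) : JoinAdm := MkJoinAdm (cylP s) in
  let MAP (g : JoinAdm) : Subdiv := MkSubdiv (mapP g) in
  [/\ (forall s s' : Subdiv,
         subdiv_isomorphic s s' <-> pointed_isomorphic (CYL s) (CYL s')),
      (forall g g' : JoinAdm,
         pointed_isomorphic g g' <-> subdiv_isomorphic (MAP g) (MAP g')),
      (forall s : Subdiv,
         exists (f : sd_X s -> sd_X (MAP (CYL s)))
                (h : sd_Y s -> sd_Y (MAP (CYL s))),
           [/\ subdiv_iso f h,
               forall x : sd_X s, val (f x) = inl x :> Cyl (subdiv_mono s)
             & forall y : sd_Y s, val (h y) = inr y :> Cyl (subdiv_mono s)])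
    & (forall g : JoinAdm,
         exists f : pd_poset (CYL (MAP g)) -> pd_poset g,
           [/\ pointed_iso f,
               forall x : sd_X (MAP g),
                 f (inl x : Cyl (subdiv_mono (MAP g))) = val x
             & forall y : sd_Y (MAP g),
                 f (inr y : Cyl (subdiv_mono (MAP g))) = val y])].
Proof.
exists is_join_adm_CYL, is_subdiv_MAP.
have MAP_CYL_iso (s : Subdiv) : subdiv_isomorphic s (MAP (CYL s)).
  by have [f [h [fh _ _]]] := MAP_CYL s; exists f, h.
have CYL_MAP_iso (g : JoinAdm) : pointed_isomorphic (CYL (MAP g)) g.
  by have [f [fP _ _]] := CYL_MAP g; exists f.
(* Reflection of isomorphism is obtained by applying the other construction and
   cancelling the round trips. *)
split; [move=> s s' | move=> g g' | exact: MAP_CYL | exact: CYL_MAP].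
  split=> [|CYLss']; first exact: CYL_isomorphic.
  apply: subdiv_isomorphic_trans (MAP_CYL_iso s) _.
  apply: subdiv_isomorphic_trans (@MAP_isomorphic (CYL s) (CYL s') CYLss') _.
  exact: subdiv_isomorphic_sym.
split=> [|MAPgg']; first exact: MAP_isomorphic.
apply: pointed_isomorphic_trans (CYL_MAP_iso g').
apply: pointed_isomorphic_trans (@CYL_isomorphic (MAP g) (MAP g') MAPgg').
exact: pointed_isomorphic_sym.
Qed.
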